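(* ${\sf CAC}$ is not computably reducible to $\omega\text{-}{\sf CAC}$, i.e. ${\sf CAC}\not\le_c\omega\text{-}{\sf CAC}$.
   Context: A poset $(P,\le_P)$ consists of $P\subseteq\omega$ and a reflexive, antisymmetric, transitive relation $\le_P$; chains (antichains) are sets of pairwise comparable (incomparable) elements; it is $\omega$-ordered if $x\le_P y$ implies $x\le y$. ${\sf CAC}$ is the problem whose instances are infinite posets with $P\subseteq\omega$ and whose solutions are infinite chains or infinite antichains of the instance; $\omega\text{-}{\sf CAC}$ is its restriction to $\omega$-ordered instances. For problems $\mathsf P,\mathsf Q$, $\mathsf P\le_c\mathsf Q$ means: for every $\mathsf P$-instance $X$ there is a $\mathsf Q$-instance $\hat X\le_T X$ such that for every solution $\hat Y$ of $\hat X$ there is a solution $Y$ of $X$ with $Y\le_T X\oplus\hat Y$. *)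

(* Defs.v *)
(* Stdlib only; sets of natural numbers are classical predicates. *)
From Stdlib Require Import Arith List Cantor.

Definition set := nat -> Prop.

Notation "<| x , y |>" := (Cantor.to_nat (x, y)) (at level 0).

(** * Turing reducibility *)

(** Programs for the partial functions on [nat] that are recursive in an
    oracle.  All functions are unary: several arguments are passed as one
    number through the Cantor bijection. *)
Inductive code : Type :=
| Zero : code
| Succ : code
| Fst : code
| Snd : code
| Query : code
| Pair : code -> code -> code
| Comp : code -> code -> code
| Prec : code -> code -> code
| Mu : code -> code.

(** The graph of the characteristic function of [A]. *)
Definition char (A : set) (x y : nat) : Prop :=
  (A x /\ y = 1) \/ (~ A x /\ y = 0).

(** [h(a,0) = F(a)] and [h(a,n+1) = G(a,(n,h(a,n)))], on graphs of partial
    functions. *)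
Fixpoint primrec (F G : nat -> nat -> Prop) (a n y : nat) : Prop :=
  match n with
  | 0 => F a y
  | S m => exists r, primrec F G a m r /\ G <|a, <|m, r|>|> y
  end.

(** [eval B e x y]: the program [e] with oracle [B] halts on input [x] with
    output [y]; this is functional in [y]. *)
Fixpoint eval (B : set) (e : code) (x y : nat) : Prop :=
  match e with
  | Zero => y = 0
  | Succ => y = S x
  | Fst => y = fst (Cantor.of_nat x)
  | Snd => y = snd (Cantor.of_nat x)
  | Query => char B x y
  | Pair f g => exists u v, eval B f x u /\ eval B g x v /\ y = <|u, v|>
  | Comp f g => exists u, eval B g x u /\ eval B f u y
  | Prec f g =>
      primrec (eval B f) (eval B g)
        (fst (Cantor.of_nat x)) (snd (Cantor.of_nat x)) y
  | Mu f =>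
      eval B f <|x, y|> 0 /\
      forall m, m < y -> exists k, eval B f <|x, m|> (S k)
  end.

Definition turing_reducible (A B : set) : Prop :=
  exists e : code, forall x y : nat, eval B e x y <-> char A x y.

Definition join (A B : set) : set :=
  fun n => exists m, (n = 2 * m /\ A m) \/ (n = 2 * m + 1 /\ B m).

(** * Problems and computable reducibility *)

Record problem : Type := Problem {
  instance : set -> Prop;
  solution : set -> set -> Prop  (* only meaningful on instances *)
}.

Definition computably_reducible (P Q : problem) : Prop :=
  forall X : set, instance P X ->
  exists X' : set,
    instance Q X' /\ turing_reducible X' X /\
    forall Y' : set, solution Q X' Y' ->
    exists Y : set, solution P X Y /\ turing_reducible Y (join X Y').

(** * Posets *)

Definition finite (A : set) : Prop :=
  exists l : list nat, forall x, A x -> In x l.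

Definition infinite (A : set) : Prop := ~ finite A.

Definition is_poset (P : set) (le : nat -> nat -> Prop) : Prop :=
  (forall x y, le x y -> P x /\ P y) /\
  (forall x, P x -> le x x) /\
  (forall x y, le x y -> le y x -> x = y) /\
  (forall x y z, le x y -> le y z -> le x z).

Definition omega_ordered (le : nat -> nat -> Prop) : Prop :=
  forall x y, le x y -> x <= y.

Definition chain (P : set) (le : nat -> nat -> Prop) (S : set) : Prop :=
  (forall x, S x -> P x) /\
  (forall x y, S x -> S y -> le x y \/ le y x).

Definition antichain (P : set) (le : nat -> nat -> Prop) (S : set) : Prop :=
  (forall x, S x -> P x) /\
  (forall x y, S x -> S y -> x <> y -> ~ le x y /\ ~ le y x).

(** A pair [(P, le)] is presented as the single set
    [join P {<|x, y|> | le x y}]; every set [X] is the join of its two halves,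
    and these functions recover [P] and [le] from it. *)
Definition carrier (X : set) : set := fun x => X (2 * x).
Definition order (X : set) : nat -> nat -> Prop :=
  fun x y => X (2 * <|x, y|> + 1).

Definition CAC : problem := {|
  instance X := is_poset (carrier X) (order X) /\ infinite (carrier X);
  solution X Y :=
    infinite Y /\
    (chain (carrier X) (order X) Y \/ antichain (carrier X) (order X) Y)
|}.

Definition omega_CAC : problem := {|
  instance X := instance CAC X /\ omega_ordered (order X);
  solution X Y := solution CAC X Y
|}.

(* Main.v *)
From Stdlib Require Import Arith List Lia Cantor Classical ClassicalEpsilon.
Require Import Defs.
Import ListNotations.

(** The instance is a generic partial order [r] on [nat].  It is built from finite
    orders whose points carry a label, a promise to lie below, above, or
    incomparable to all later points.  A chain of [r] that contains a point
    labelled [Inc], or an antichain that contains one labelled [Up] or [Down], is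
    finite; so a program is defeated by making it accept a point and then
    choosing the label of that point.

    Let [e] compute an omega-ordered poset from [r].  A chain and an antichain of
    it are grown together inside a reservoir, and for every pair of requirements,
    one for each of them, one of the two is met; hence all requirements are met on
    one side.  Suppose that the chain side wants a label [c1] and the antichain
    side a label [c].  Collect the top elements of chains that accept a point;
    among them find an antichain [Z] that accepts a point, everything inside a new
    block of points, and label that block [c].  If [Z] cannot be continued then
    some [z] in [Z] has infinitely many elements above it.  Among these find an
    accepting antichain [Z'], using a second block, which relates to the first one
    according to [c].  Now relabel the blocks [c1] and [c2], with [c2] also suitable
    for the antichain side.  Either [Z'] can be continued, or some element of [Z']
    can be continued as a chain, together with the chain below [z].  The labels
    [(c; c1, c2)] are [(Up; Inc, Down)] when the chain side wants [Inc] and the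
    antichain side does not, and [(Inc; Up, Inc)] in the opposite case; otherwise
    they are constant.  The first of these needs all three labels, since a point
    above a point labelled [Inc] cannot be labelled [Up]. *)

(** * The use principle for oracle computations *)

Definition agree (m : nat) (B B' : set) : Prop :=
  forall z, z < m -> (B z <-> B' z).

Lemma agree_le m n B B' : m <= n -> agree n B B' -> agree m B B'.
Proof. intros H K z Hz. apply K. lia. Qed.

Definition continuous (Q : set -> Prop) : Prop :=
  forall B, Q B -> exists m, forall B', agree m B B' -> Q B'.

Lemma continuous_const (Q : Prop) : continuous (fun _ => Q).
Proof. intros B H. exists 0. auto. Qed.

Lemma continuous_and Q Q' :
  continuous Q -> continuous Q' -> continuous (fun B => Q B /\ Q' B).
Proof.
  intros H H' B [K K'].
  destruct (H B K) as [m Hm], (H' B K') as [m' Hm'].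
  exists (max m m'). intros B' HB. split.
  - apply Hm. apply (agree_le _ (max m m')); auto; lia.
  - apply Hm'. apply (agree_le _ (max m m')); auto; lia.
Qed.

Lemma continuous_ex {T} (Q : T -> set -> Prop) :
  (forall t, continuous (Q t)) -> continuous (fun B => exists t, Q t B).
Proof.
  intros H B [t K]. destruct (H t B K) as [m Hm]. exists m. eauto.
Qed.

Lemma continuous_forall_lt (Q : nat -> set -> Prop) n :
  (forall t, continuous (Q t)) -> continuous (fun B => forall t, t < n -> Q t B).
Proof.
  intros H. induction n as [|n IH]; intros B K.
  - exists 0. intros; lia.
  - destruct (IH B) as [m Hm]; [intros; apply K; lia|].
    destruct (H n B (K n ltac:(lia))) as [m' Hm'].
    exists (max m m'). intros B' HB t Ht.
    destruct (Nat.eq_dec t n) as [->|Hn].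
    + apply Hm'. apply (agree_le _ (max m m')); auto; lia.
    + apply Hm; [|lia]. apply (agree_le _ (max m m')); auto; lia.
Qed.

(** Halting is built from single queries by conjunction, existential and bounded universal
    quantifiers, and all of these preserve openness in Cantor space. *)
Lemma eval_continuous e x y : continuous (fun B => eval B e x y).
Proof.
  revert x y. induction e as [| | | | |f IHf g IHg|f IHf g IHg|f IHf g IHg|f IHf];
    intros x y; simpl.
  1-4: apply continuous_const.
  - intros B H. exists (S x). intros B' HB. unfold char in *.
    rewrite <- (HB x ltac:(lia)). exact H.
  - apply continuous_ex; intros u. apply continuous_ex; intros v.
    repeat apply continuous_and; auto. apply continuous_const.
  - apply continuous_ex; intros u. apply continuous_and; auto.
  - generalize (fst (Cantor.of_nat x)) as a. generalize (snd (Cantor.of_nat x)) as n.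
    intros n a. revert y. induction n as [|n IH]; intros y; simpl; auto.
    apply continuous_ex; intros u. apply continuous_and; auto.
  - apply continuous_and; auto. apply continuous_forall_lt. intros t.
    apply continuous_ex; auto.
Qed.

Definition oracle (r : nat -> nat -> Prop) : set :=
  join (fun _ => True)
       (fun z => r (fst (Cantor.of_nat z)) (snd (Cantor.of_nat z))).

Lemma carrier_oracle r x : carrier (oracle r) x.
Proof. exists x. auto. Qed.

Lemma order_oracle r x y : order (oracle r) x y <-> r x y.
Proof.
  unfold order, oracle, join. split.
  - intros [m [[H _]|[H K]]]; [lia|].
    replace m with (<| x, y |>) in K by lia.
    rewrite cancel_of_to in K. exact K.
  - intros H. exists <| x, y |>. right. rewrite cancel_of_to. auto.
Qed.

Lemma oracle_agree m r r' :
  (forall x y, x < m -> y < m -> (r x y <-> r' x y)) ->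
  agree m (oracle r) (oracle r').
Proof.
  intros H z Hz. unfold oracle, join.
  assert (E : forall k, z = 2 * k + 1 ->
            (r (fst (Cantor.of_nat k)) (snd (Cantor.of_nat k)) <->
             r' (fst (Cantor.of_nat k)) (snd (Cantor.of_nat k)))).
  { intros k Hk. pose proof (cancel_to_of k) as C.
    destruct (Cantor.of_nat k) as [a b]. simpl.
    pose proof (to_nat_non_decreasing a b). apply H; lia. }
  split; intros [k [K|[K K']]]; exists k; auto; right; split; auto; apply (E k K); auto.
Qed.

Lemma join_agree m A A' B B' :
  agree m A A' -> agree m B B' -> agree m (join A B) (join A' B').
Proof.
  intros HA HB z Hz. unfold join.
  split; intros [k [[K K']|[K K']]]; exists k; [left|right|left|right];
    split; auto; (apply HA || apply HB); auto; lia.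
Qed.

(** * Forcing conditions *)

Inductive label := Up | Down | Inc.

Definition stable (c : label) (r : nat -> nat -> Prop) (x y : nat) : Prop :=
  match c with
  | Up => r x y /\ ~ r y x
  | Down => r y x /\ ~ r x y
  | Inc => ~ r x y /\ ~ r y x
  end.

(** Coherence of all pairs is what makes it possible to add a point that
    respects every label. *)
Definition coherent (r : nat -> nat -> Prop) (cx cy : label) (x y : nat) : Prop :=
  (r x y -> (cy = Up -> cx = Up) /\ (cx = Down -> cy = Down)) /\
  (cx = Up -> cy = Down -> r x y).

Record cond := Cond {
  sz : nat;
  rel : nat -> nat -> Prop;
  lab : nat -> label
}.

Definition matches (p : cond) (r : nat -> nat -> Prop) : Prop :=
  forall x y, x < sz p -> y < sz p -> (r x y <-> rel p x y).

Record valid (p : cond) : Prop := {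
  valid_refl : forall x, x < sz p -> rel p x x;
  valid_antisym : forall x y, x < sz p -> y < sz p ->
    rel p x y -> rel p y x -> x = y;
  valid_trans : forall x y z, x < sz p -> y < sz p -> z < sz p ->
    rel p x y -> rel p y z -> rel p x z;
  valid_coherent : forall x y, x < sz p -> y < sz p ->
    coherent (rel p) (lab p x) (lab p y) x y
}.

Definition sub (p q : cond) : Prop := sz p <= sz q /\ matches p (rel q).

Record ext (q p : cond) : Prop := {
  ext_valid : valid q;
  ext_sub : sub p q;
  ext_lab : forall x, x < sz p -> lab q x = lab p x;
  ext_stable : forall x y, x < sz p -> sz p <= y -> y < sz q ->
    stable (lab p x) (rel q) x y
}.

Lemma sub_refl p : sub p p.
Proof. split; auto. intros x y _ _. tauto. Qed.

Lemma sub_trans p q r : sub p q -> sub q r -> sub p r.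
Proof.
  intros [H H'] [K K']. split; [lia|].
  intros x y Hx Hy. rewrite (K' x y) by lia. apply H'; auto.
Qed.

Lemma matches_sub p q r : sub p q -> matches q r -> matches p r.
Proof.
  intros [H H'] K x y Hx Hy. rewrite (K x y) by lia. apply H'; auto.
Qed.

Lemma ext_refl p : valid p -> ext p p.
Proof. intros H. split; auto using sub_refl. intros; lia. Qed.

Lemma stable_iff c r r' x y :
  (r x y <-> r' x y) -> (r y x <-> r' y x) -> stable c r x y -> stable c r' x y.
Proof. destruct c; simpl; tauto. Qed.

Lemma ext_trans r q p : ext r q -> ext q p -> ext r p.
Proof.
  intros [V S L T] [V' S' L' T']. split; auto.
  - eapply sub_trans; eauto.
  - intros x Hx. destruct S'. rewrite L by lia. auto.
  - intros x y Hx Hy Hy'. destruct S as [S1 S2], S' as [S1' S2'].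
    destruct (le_lt_dec (sz q) y) as [Hq|Hq].
    + rewrite <- L' by auto. apply T; lia.
    + apply (stable_iff _ (rel q)).
      * symmetry. apply S2; lia.
      * symmetry. apply S2; lia.
      * apply T'; auto.
Qed.

(** Pairs of an old and a new point are coherent whatever label the new one has, since [ext_stable]
    already places it as the old label demands. So only pairs of new points need checking. *)
Lemma relabel q p l :
  ext q p -> valid p ->
  (forall x, x < sz p -> l x = lab p x) ->
  (forall x y, sz p <= x < sz q -> sz p <= y < sz q ->
     coherent (rel q) (l x) (l y) x y) ->
  ext (Cond (sz q) (rel q) l) p.
Proof.
  intros [[V1 V2 V3 V4] [S1 S2] L T] Vp Hl Hc. split; simpl; auto.
  2: split; auto.
  split; simpl; auto.
  intros x y Hx Hy.
  destruct (le_lt_dec (sz p) x) as [Px|Px], (le_lt_dec (sz p) y) as [Py|Py].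
  - apply Hc; lia.
  - rewrite (Hl y) by auto. specialize (T y x Py Px Hx).
    destruct (lab p y); simpl in T; unfold coherent; intuition congruence.
  - rewrite (Hl x) by auto. specialize (T x y Px Py Hy).
    destruct (lab p x); simpl in T; unfold coherent; intuition congruence.
  - rewrite !Hl by auto. rewrite <- !L by auto. auto.
Qed.

Definition relabel1 (c : label) (p q : cond) : cond :=
  Cond (sz q) (rel q) (fun x => if x <? sz p then lab p x else c).

Lemma relabel1_ext c q p : valid p -> ext q p -> ext (relabel1 c p q) p.
Proof.
  intros Vp H. apply relabel; auto.
  - intros x Hx. apply Nat.ltb_lt in Hx. rewrite Hx. auto.
  - intros x y Hx Hy.
    destruct (x <? sz p) eqn:Ex; [apply Nat.ltb_lt in Ex; lia|].
    destruct (y <? sz p) eqn:Ey; [apply Nat.ltb_lt in Ey; lia|].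
    destruct c; unfold coherent; intuition congruence.
Qed.

Lemma relabel1_lab c p q x : sz p <= x -> lab (relabel1 c p q) x = c.
Proof.
  intros H. simpl. destruct (x <? sz p) eqn:Ex; auto.
  apply Nat.ltb_lt in Ex; lia.
Qed.

Definition relabel2 (c1 c2 : label) (p q q' : cond) : cond :=
  Cond (sz q') (rel q')
    (fun x => if x <? sz p then lab p x else if x <? sz q then c1 else c2).

(** If all points of a second block relate to the first one as [c] prescribes,
    then the two blocks may be labelled [c1] and [c2] instead. *)
Definition compatible (c c1 c2 : label) : Prop :=
  forall r x y, stable c r x y -> coherent r c1 c2 x y /\ coherent r c2 c1 y x.

(** Points of one block share a label; across blocks [stable c] holds because [q'] was built over
    [relabel1 c p q], so [compatible] applies. *)
Lemma relabel2_ext c c1 c2 p q q' :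
  valid p -> compatible c c1 c2 -> ext q p -> ext q' (relabel1 c p q) ->
  ext (relabel2 c1 c2 p q q') p.
Proof.
  intros Vp C H H'. pose proof (relabel1_ext c q p Vp H) as H1.
  apply relabel; auto.
  - eapply ext_trans; eauto.
  - intros x Hx. apply Nat.ltb_lt in Hx. rewrite Hx. auto.
  - intros x y Hx Hy.
    destruct (x <? sz p) eqn:Ex; [apply Nat.ltb_lt in Ex; lia|].
    destruct (y <? sz p) eqn:Ey; [apply Nat.ltb_lt in Ey; lia|].
    assert (D : forall d, coherent (rel q') d d x y)
      by (intros []; unfold coherent; intuition congruence).
    destruct (x <? sz q) eqn:Fx, (y <? sz q) eqn:Fy; auto;
      rewrite ?Nat.ltb_lt, ?Nat.ltb_ge in *.
    + refine (proj1 (C (rel q') x y _)). rewrite <- (relabel1_lab c p q x) by lia.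
      apply (ext_stable _ _ H'); simpl; lia.
    + refine (proj2 (C (rel q') y x _)). rewrite <- (relabel1_lab c p q y) by lia.
      apply (ext_stable _ _ H'); simpl; lia.
Qed.

Lemma relabel2_lab1 c1 c2 p q q' x :
  sz p <= x < sz q -> lab (relabel2 c1 c2 p q q') x = c1.
Proof.
  intros H. simpl. destruct (x <? sz p) eqn:Ex, (x <? sz q) eqn:Ey; auto;
  rewrite ?Nat.ltb_lt, ?Nat.ltb_ge in *; lia.
Qed.

Lemma relabel2_lab2 c1 c2 p q q' x :
  sz p <= x -> sz q <= x -> lab (relabel2 c1 c2 p q q') x = c2.
Proof.
  intros H. simpl. destruct (x <? sz p) eqn:Ex, (x <? sz q) eqn:Ey; auto;
  rewrite ?Nat.ltb_lt, ?Nat.ltb_ge in *; lia.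
Qed.

(** The new point goes above exactly the [Up] points and below exactly the [Down] points.
    Transitivity is coherence: [Up] is closed downwards, [Down] upwards, and every [Up] point lies
    below every [Down] point. *)
Lemma ext_one p : valid p -> exists q, ext q p /\ sz q = S (sz p).
Proof.
  intros [V1 V2 V3 V4].
  set (n := sz p) in *.
  exists (Cond (S n)
    (fun x y => (x < n /\ y < n /\ rel p x y) \/ (x = n /\ y = n) \/
                (x < n /\ y = n /\ lab p x = Up) \/
                (x = n /\ y < n /\ lab p y = Down))
    (fun x => if x <? n then lab p x else Inc)).
  split; auto. split; simpl.
  - split; simpl.
    + intros x Hx. destruct (Nat.eq_dec x n); auto. left. split; [lia|]. split; [lia|].
      apply V1; lia.
    + intros x y Hx Hy.
      intros [A|[A|[A|A]]] [B|[B|[B|B]]]; try lia.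
      * apply V2; tauto.
      * destruct A as (?&?&A), B as (?&?&B). congruence.
      * destruct A as (?&?&A), B as (?&?&B). congruence.
    + intros x y z Hx Hy Hz.
      intros [A|[A|[A|A]]] [B|[B|[B|B]]]; try lia.
      * left. destruct A as (?&?&A), B as (?&?&B). eauto 10.
      * destruct A as (?&?&A), B as (?&?&B). right; right; left.
        repeat split; auto. apply (V4 x y); auto.
      * replace x with y by lia. tauto.
      * replace z with y by lia. tauto.
      * destruct A as (?&?&A), B as (?&?&B). left. repeat split; auto.
        apply (V4 x z); auto.
      * destruct A as (?&?&A), B as (?&?&B). right; right; right.
        repeat split; auto. apply (V4 y z); auto.
    + intros x y Hx Hy.
      destruct (x <? n) eqn:Ex, (y <? n) eqn:Ey;
        rewrite ?Nat.ltb_lt, ?Nat.ltb_ge in *; unfold coherent.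
      * destruct (V4 x y) as [C1 C2]; auto. split.
        -- intros [A|[A|[A|A]]]; try lia. tauto.
        -- auto.
      * split; [|congruence]. intros [A|[A|[A|A]]]; try lia.
        destruct A as (?&?&A). rewrite A. split; congruence.
      * split; [|congruence]. intros [A|[A|[A|A]]]; try lia.
        destruct A as (?&?&A). rewrite A. split; congruence.
      * split; [|congruence]. split; congruence.
  - split; simpl; [lia|]. intros x y Hx Hy. simpl. fold n in Hx, Hy. split.
    + intros [A|[A|[A|A]]]; try lia. tauto.
    + intros A. left. auto.
  - intros x Hx. fold n in Hx. apply Nat.ltb_lt in Hx. rewrite Hx. auto.
  - intros x y Hx Hy Hy'. fold n in Hx, Hy. assert (y = n) by lia. subst y.
    destruct (lab p x) eqn:E; simpl; split; try tauto; intros B;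
      repeat destruct B as [B|B]; try lia; destruct B as (?&?&B); congruence.
Qed.

Lemma ext_large p n : valid p -> exists q, ext q p /\ n <= sz q.
Proof.
  intros V. induction n as [|n (q & Hq & Hn)].
  - exists p. split; [apply ext_refl; auto|lia].
  - destruct (ext_one q (ext_valid _ _ Hq)) as (q' & H & E).
    exists q'. split; [eapply ext_trans; eauto|lia].
Qed.

(** * Reservoirs and the disjunctive step *)

(** A set of numbers attached to the generic order.  Monotonicity is along
    [sub], not [ext]: membership must survive a change of labels. *)
Definition name := cond -> nat -> Prop.

Definition monotone (R : name) : Prop :=
  forall p q b, sub p q -> R p b -> R q b.

(** This says that [p] forces the set named by [R] to be infinite. *)
Definition dense (p : cond) (R : name) : Prop :=
  forall q, ext q p -> forall N, exists q' b, ext q' q /\ N <= b /\ R q' b.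

Lemma dense_ext q p R : ext q p -> dense p R -> dense q R.
Proof. intros H D q' H'. apply D. eapply ext_trans; eauto. Qed.

Lemma dense_above u p R : dense p R -> dense p (fun q b => R q b /\ u <= b).
Proof.
  intros D q H N. destruct (D q H (max N u)) as (q' & b & H1 & H2 & H3).
  exists q', b. split; [auto|]. split; [lia|]. split; [auto|lia].
Qed.

(** All relations [r] that match [p] are allowed, whatever the labels, so forced facts survive
    relabelling. *)
Definition forced (e : code) (p : cond) (z v : nat) : Prop :=
  forall r, matches p r -> eval (oracle r) e z v.

Lemma forced_sub e p q z v : sub p q -> forced e p z v -> forced e q z v.
Proof. intros H F r K. apply F. eapply matches_sub; eauto. Qed.

Definition elt (e : code) : name := fun p b => forced e p (2 * b) 1.
Definition below (e : code) (p : cond) (a b : nat) : Prop :=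
  forced e p (2 * <| a, b |> + 1) 1.
Definition notbelow (e : code) (p : cond) (a b : nat) : Prop :=
  forced e p (2 * <| a, b |> + 1) 0.

Definition decided (e : code) (p : cond) : Prop :=
  forall q z, ext q p -> exists q', ext q' q /\ (forced e q' z 1 \/ forced e q' z 0).

Lemma decided_ext e q p : ext q p -> decided e p -> decided e q.
Proof. intros H D q' z H'. apply D. eapply ext_trans; eauto. Qed.

(** Lists are built by consing, so the head is the newest element. *)
Definition above (e : code) (p : cond) (l : list nat) (b : nat) : Prop :=
  match l with [] => True | a :: _ => below e p a b end.

(** Here the omega-order enters: [a < b] excludes [b] below [a], so a single computation with output
    0 certifies incomparability. *)
Definition free (e : code) (p : cond) (l : list nat) (b : nat) : Prop :=
  forall a, In a l -> a < b /\ notbelow e p a b.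

(** Only consecutive elements are required to be comparable, since transitivity
    of the coded order is not a forced fact. *)
Fixpoint cpath (e : code) (p : cond) (l : list nat) : Prop :=
  match l with
  | [] => True
  | b :: l' => elt e p b /\ above e p l' b /\ cpath e p l'
  end.

Fixpoint apath (e : code) (p : cond) (l : list nat) : Prop :=
  match l with
  | [] => True
  | b :: l' => elt e p b /\ free e p l' b /\ apath e p l'
  end.

Lemma above_sub e p q l b : sub p q -> above e p l b -> above e q l b.
Proof. destruct l; simpl; auto. intros H. apply forced_sub; auto. Qed.

Lemma free_sub e p q l b : sub p q -> free e p l b -> free e q l b.
Proof.
  intros H F a Ha. destruct (F a Ha). split; auto. eapply forced_sub; eauto.
Qed.

Lemma cpath_sub e p q l : sub p q -> cpath e p l -> cpath e q l.
Proof.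
  intros H. induction l; simpl; auto. intros (A & B & C).
  split; [|split]; auto.
  - eapply forced_sub; eauto.
  - eapply above_sub; eauto.
Qed.

Lemma apath_sub e p q l : sub p q -> apath e p l -> apath e q l.
Proof.
  intros H. induction l; simpl; auto. intros (A & B & C).
  split; [|split]; auto.
  - eapply forced_sub; eauto.
  - eapply free_sub; eauto.
Qed.

Lemma cpath_elt e p l x : cpath e p l -> In x l -> elt e p x.
Proof.
  induction l as [|b l IH]; intros W I; [destruct I|].
  destruct I as [<-|I]; [apply W|apply IH; auto; apply W].
Qed.

Lemma apath_elt e p l x : apath e p l -> In x l -> elt e p x.
Proof.
  induction l as [|b l IH]; intros W I; [destruct I|].
  destruct I as [<-|I]; [apply W|apply IH; auto; apply W].
Qed.

(** The requirement on a program is that the set it computes either contains an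
    element labelled [Inc] ([iso = true]), respectively [Up] or [Down]
    ([iso = false]), or has no new elements.  Asking in [accepts] for an element
    of the list that is at least [low] lets a constant program express that the
    list grows. *)
Record req := Req { prog : code; iso : bool; low : nat }.

Definition kind (k : bool) (c : label) : Prop :=
  if k then c = Inc else c <> Inc.

Definition accepts (rho : req) (p : cond) (l : list nat) (u y : nat) : Prop :=
  (exists x, In x l /\ low rho <= x) /\
  forall r Y, matches p r -> (forall z, z < u -> (Y z <-> In z l)) ->
    eval (join (oracle r) Y) (prog rho) y 1.

Lemma accepts_sub rho p q l u y :
  sub p q -> accepts rho p l u y -> accepts rho q l u y.
Proof.
  intros H [A B]. split; auto. intros r Y K. apply B. eapply matches_sub; eauto.
Qed.

Lemma accepts_app rho p l' l u y :
  (forall x, In x l' -> u <= x) ->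
  accepts rho p l u y -> accepts rho p (l' ++ l) u y.
Proof.
  intros H [(x & Hx & Hx') B]. split.
  - exists x. split; auto. apply in_or_app; auto.
  - intros r Y K L. apply B; auto. intros z Hz. rewrite (L z Hz), in_app_iff.
    split; auto. intros [I|I]; auto. specialize (H z I). lia.
Qed.

(** In the first alternative later elements of the list are at least [u], so they
    do not disturb the accepting computation. *)
Definition met (ok : cond -> list nat -> Prop) (p : cond) (R : name)
    (l : list nat) (rho : req) : Prop :=
  (exists y u, y < sz p /\ kind (iso rho) (lab p y) /\ accepts rho p l u y /\
     forall q b, R q b -> u <= b) \/
  (forall q l' u y, ext q p -> (forall x, In x l' -> R q x) -> ok q (l' ++ l) ->
     sz p <= y < sz q -> ~ accepts rho q (l' ++ l) u y).

(** A Mathias condition with two stems, [chn] and [ant], and a common reservoir; [xstate] is its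
    extension relation. *)
Record state := State { chn : list nat; ant : list nat; res : name }.

Record vstate (e : code) (p : cond) (s : state) : Prop := {
  v_decided : decided e p;
  v_mono : monotone (res s);
  v_dense : dense p (res s);
  v_chn : cpath e p (chn s);
  v_ant : apath e p (ant s);
  v_res : forall q b, res s q b ->
    elt e q b /\ above e q (chn s) b /\ free e q (ant s) b
}.

Record xstate (q : cond) (s' s : state) : Prop := {
  x_chn : exists l, chn s' = l ++ chn s /\ forall x, In x l -> res s q x;
  x_ant : exists l, ant s' = l ++ ant s /\ forall x, In x l -> res s q x;
  x_res : forall q' b, res s' q' b -> res s q' b
}.

Lemma vstate_ext e q p s : ext q p -> vstate e p s -> vstate e q s.
Proof.
  intros H [A B C D E F]. pose proof (ext_sub _ _ H). split; auto.
  - eapply decided_ext; eauto.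
  - eapply dense_ext; eauto.
  - eapply cpath_sub; eauto.
  - eapply apath_sub; eauto.
Qed.

Lemma xstate_refl q s : xstate q s s.
Proof. split; auto; exists []; split; auto; intros x []. Qed.

Lemma xstate_trans r q s2 s1 s0 :
  monotone (res s0) -> sub q r -> xstate q s1 s0 -> xstate r s2 s1 ->
  xstate r s2 s0.
Proof.
  intros M S [(l & A & A') (m & B & B') C] [(l2 & A2 & A2') (m2 & B2 & B2') C2].
  split; auto.
  - exists (l2 ++ l). rewrite A2, A, app_assoc. split; auto.
    intros x I. apply in_app_or in I as [I|I]; eauto.
  - exists (m2 ++ m). rewrite B2, B, app_assoc. split; auto.
    intros x I. apply in_app_or in I as [I|I]; eauto.
Qed.

Lemma vstate_step e p q s l m R :
  vstate e p s -> ext q p ->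
  monotone R -> dense q R ->
  cpath e q (l ++ chn s) -> apath e q (m ++ ant s) ->
  (forall x, In x l -> res s q x) -> (forall x, In x m -> res s q x) ->
  (forall q' b, R q' b -> res s q' b /\ above e q' l b /\ free e q' m b) ->
  vstate e q (State (l ++ chn s) (m ++ ant s) R) /\
  xstate q (State (l ++ chn s) (m ++ ant s) R) s.
Proof.
  intros V X M D C A L' M' K. split.
  - split; simpl; auto.
    + eapply decided_ext; eauto. apply V.
    + intros q' b H. destruct (K q' b H) as (K1 & K2 & K3).
      destruct (v_res _ _ _ V q' b K1) as (E1 & E2 & E3).
      split; [|split]; auto.
      * destruct l; simpl; auto.
      * intros a I. apply in_app_or in I as [I|I]; auto.
  - split; simpl; eauto. intros q' b H. apply (K q' b H).
Qed.

(** Treat the elements of [Z] one by one. If the elements above [z] are not dense, some extension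
    forbids all large ones, and then [decided] lets one force [z] not below them. *)
Lemma split_reservoir e p R Z :
  valid p -> monotone R -> dense p R -> decided e p ->
  (exists z q, In z Z /\ ext q p /\ dense q (fun q b => R q b /\ below e q z b)) \/
  (exists q, ext q p /\ dense q (fun q b => R q b /\ free e q Z b)).
Proof.
  intros V M D T. induction Z as [|z Z IH].
  - right. exists p. split; [apply ext_refl; auto|].
    intros q H N. destruct (D q H N) as (q' & b & H1 & H2 & H3).
    exists q', b. split; [auto|]. split; [auto|]. split; [auto|]. intros a [].
  - destruct IH as [(a & q & I & IH)|(q1 & X1 & D1)].
    { left. exists a, q. split; [right|]; auto. }
    destruct (classic (dense q1 (fun q b => R q b /\ below e q z b))) as [C|C].
    { left. exists z, q1. simpl. auto. }
    right.
    apply not_all_ex_not in C as [q2 C]. apply imply_to_and in C as [X2 C].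
    apply not_all_ex_not in C as [N C].
    exists q2. split; [eapply ext_trans; eauto|].
    intros q X L.
    destruct (D1 q (ext_trans _ _ _ X X2) (max N (max L (S z))))
      as (q3 & b & X3 & Hb & R3 & F3).
    assert (X30 : ext q3 p) by eauto using ext_trans.
    destruct (T q3 (2 * <| z, b |> + 1) X30) as (q4 & X4 & [B4|B4]).
    { exfalso. apply C. exists q4, b.
      split; [eauto using ext_trans|]. split; [lia|]. split; auto.
      eapply M; eauto. apply ext_sub; auto. }
    exists q4, b. split; [eauto using ext_trans|]. split; [lia|].
    split; [eapply M; eauto; apply ext_sub; auto|].
    intros a [<-|I].
    + split; [lia|auto].
    + eapply free_sub; eauto. apply ext_sub; auto.
Qed.

Lemma compatible_labels k0 k1 : exists c c1 c2,
  kind k1 c /\ kind k0 c1 /\ kind k1 c2 /\ compatible c c1 c2.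
Proof.
  destruct k1; [exists Inc, (if k0 then Inc else Up), Inc
               |exists Up, (if k0 then Inc else Up), (if k0 then Down else Up)];
    destruct k0; simpl; repeat split; try discriminate;
    simpl in *; intuition congruence.
Qed.

Lemma progress e p s rho0 rho1 :
  valid p -> vstate e p s ->
  exists q s', ext q p /\ vstate e q s' /\ xstate q s' s /\
    (met (cpath e) q (res s') (chn s') rho0 \/
     met (apath e) q (res s') (ant s') rho1).
Proof.
  intros Vp Vs. pose proof Vs as [T M D C A K]. apply NNPP. intros Fail.
  (* [Good0] and [Good1]: an accepted list that can be continued meets its requirement, once the
     reservoir is cut to elements at least [u]. *)
  assert (Good0 : forall q l u y R, ext q p -> monotone R -> dense q R ->
    (forall x, In x l -> res s q x) -> cpath e q (l ++ chn s) ->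
    (forall q b, R q b -> res s q b /\ above e q l b) ->
    y < sz q -> kind (iso rho0) (lab q y) -> accepts rho0 q (l ++ chn s) u y -> False).
  { intros q l u y R X MR DR Il Cl HR Hy Hk Ha. apply Fail.
    destruct (vstate_step e p q s l [] (fun q b => R q b /\ u <= b)) as [V' X']; auto.
    - intros q1 q2 b S [H1 H2]. split; eauto.
    - apply dense_above; auto.
    - simpl. eapply apath_sub; eauto. apply ext_sub; auto.
    - intros x [].
    - intros q' b [H _]. destruct (HR _ _ H). repeat split; auto; destruct H2.
    - eexists q, _. split; [exact X|]. split; [exact V'|]. split; [exact X'|].
      left. left. exists y, u. simpl. repeat split; auto; try apply Ha. tauto. }
  assert (Good1 : forall q l u y, ext q p ->
    dense q (fun q b => res s q b /\ free e q l b) ->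
    (forall x, In x l -> res s q x) -> apath e q (l ++ ant s) ->
    y < sz q -> kind (iso rho1) (lab q y) -> accepts rho1 q (l ++ ant s) u y -> False).
  { intros q l u y X DR Il Cl Hy Hk Ha. apply Fail.
    destruct (vstate_step e p q s [] l
      (fun q b => (res s q b /\ free e q l b) /\ u <= b)) as [V' X']; auto.
    - intros q1 q2 b S [[H1 H2] H3]. repeat split; eauto; eapply free_sub; eauto.
    - apply dense_above; auto.
    - simpl. eapply cpath_sub; eauto. apply ext_sub; auto.
    - intros x [].
    - intros q' b [H _]. simpl. tauto.
    - eexists q, _. split; [exact X|]. split; [exact V'|]. split; [exact X'|].
      right. left. exists y, u. simpl. repeat split; auto; try apply Ha. tauto. }
  (* Shrinking the reservoir is also progress, so by [Fail] even the second alternative of [met]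
     fails for every dense subreservoir: each one yields an accepted list over some extension. *)
  assert (Shrink : forall q R, ext q p -> monotone R -> dense q R ->
    (forall q b, R q b -> res s q b) ->
    ~ met (cpath e) q R (chn s) rho0 /\ ~ met (apath e) q R (ant s) rho1).
  { intros q R X MR DR HR.
    destruct (vstate_step e p q s [] [] R) as [V' X']; auto; simpl; try tauto.
    - eapply cpath_sub; eauto. apply ext_sub; auto.
    - eapply apath_sub; eauto. apply ext_sub; auto.
    - intros q' b H. repeat split; auto; destruct H0.
    - split; intros F; apply Fail; eexists q, _; (split; [exact X|]);
      (split; [exact V'|]); (split; [exact X'|]); simpl; auto. }
  destruct (compatible_labels (iso rho0) (iso rho1)) as (c & c1 & c2 & Kc & Kc1 & Kc2 & Cc).
  (* The newest elements of accepted chains: if one of them has many elements above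
     it then the chain can go on, otherwise it is harmless in an antichain. *)
  set (top := fun q b => res s q b /\ exists l u y,
    (forall x, In x (b :: l) -> res s q x) /\ cpath e q ((b :: l) ++ chn s) /\
    sz p <= y < sz q /\ accepts rho0 q ((b :: l) ++ chn s) u y).
  assert (Mtop : monotone top).
  { intros q q' b S (H & l & u & y & H1 & H2 & H3 & H4). split; eauto.
    exists l, u, y. split; [eauto|]. split; [eapply cpath_sub; eauto|].
    split; [destruct S; lia|]. eapply accepts_sub; eauto. }
  assert (Dtop : dense p top).
  { intros q X N.
    destruct (Shrink q (fun q b => res s q b /\ N <= b)) as [F _]; auto.
    - intros q1 q2 b S [H1 H2]. eauto.
    - apply dense_above. eapply dense_ext; eauto.
    - tauto.
    - apply not_or_and in F as [_ F].
      apply NNPP. intros G. apply F. intros q' l u y X' Hl Cl Hy Ha.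
      assert (X'p : ext q' p) by eauto using ext_trans.
      assert (sz p <= sz q) by apply X.
      destruct l as [|b l].
      (* Nothing was added to the chain, so the whole reservoir still continues it, and label [c1]
         on the new points meets [rho0]. *)
      + apply (Good0 (relabel1 c1 p q') [] u y (res s)); simpl; auto.
        * apply relabel1_ext; auto.
        * eapply dense_ext; eauto. apply relabel1_ext; auto.
        * intros x [].
        * exact (cpath_sub e q' (relabel1 c1 p q') _ (sub_refl q') Cl).
        * apply Hy.
        * rewrite (proj2 (Nat.ltb_ge y (sz p))) by lia. auto.
      + apply G. exists q', b.
        split; auto. split; [apply (Hl b); simpl; auto|].
        split; [apply (Hl b); simpl; auto|].
        exists l, u, y. split; [|split; [|split]]; auto; try lia.
        intros x I. apply Hl; auto. }
  destruct (Shrink p top) as [_ F]; auto using ext_refl.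
  { intros q b H. apply H. }
  apply not_or_and in F as [_ F]. apply F.
  intros q Z u1 y1 X HZ AZ Hy1 Ac1.
  set (q1 := relabel1 c p q).
  assert (X1 : ext q1 p) by (apply relabel1_ext; auto).
  destruct (split_reservoir e q1 (res s) Z) as [(z & q2 & Iz & X2 & D2)|(q2 & X2 & D2)];
    eauto using decided_ext, dense_ext.
  { apply X1. }
  2:{ assert (S : sub q q2) by apply X2. (* [q1] and [q] carry the same order *)
      apply (Good1 q2 Z u1 y1); eauto using ext_trans.
      - intros x I. eapply M; eauto. apply HZ; auto.
      - eapply apath_sub; eauto.
      - destruct S; lia.
      - rewrite (ext_lab _ _ X2) by (simpl; lia). unfold q1.
        rewrite relabel1_lab; auto; lia.
      - eapply accepts_sub; eauto. }
  (* With label [c] on the first block the chain through [z] could go on.  Look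
     above [z] for an antichain, then give the two blocks the labels [c1], [c2]. *)
  destruct (HZ z Iz) as (Rz & l & u0 & y0 & Il & Cl & Hy0 & Ac0).
  (* The bound [u0] protects the computation that accepted the chain through [z] from elements added
     later. *)
  set (R2 := fun q b => (res s q b /\ below e q z b) /\ u0 <= b).
  assert (MR2 : monotone R2).
  { intros a a' b S [[H1 H2] H3]. repeat split; eauto; eapply forced_sub; eauto. }
  destruct (Shrink q2 R2) as [_ F2]; eauto using ext_trans.
  { apply dense_above; auto. }
  { intros a b H. apply H. }
  apply not_or_and in F2 as [_ F2]. apply F2.
  intros q3 Z3 u3 y3 X3 HZ3 AZ3 Hy3 Ac3.
  assert (X31 : ext q3 q1) by eauto using ext_trans.
  set (q4 := relabel2 c1 c2 p q q3).
  assert (X4 : ext q4 p) by (eapply relabel2_ext; eauto).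
  assert (S12 : sz q <= sz q2) by apply X2.
  assert (S23 : sz q2 <= sz q3) by apply X3.
  destruct (split_reservoir e q4 (res s) Z3) as [(b & q5 & Ib & X5 & D5)|(q5 & X5 & D5)];
    eauto using decided_ext, dense_ext.
  { apply X4. }
  - assert (S3 : sub q3 q5) by apply X5.
    assert (Sq : sub q q5) by (eapply sub_trans; [|exact S3]; apply X31).
    destruct (HZ3 b Ib) as [[H1 H2] H3].
    (* [b] continues the chain through [z]; the accepted point [y0] lies in the first block and so
       has label [c1]. *)
    apply (Good0 q5 ([b] ++ z :: l) u0 y0 (fun q x => res s q x /\ below e q b x));
      eauto using ext_trans.
    + intros a a' x S [K1 K2]. split; eauto. eapply forced_sub; eauto.
    + intros x [<-|I]; [exact (M _ _ _ S3 H1)|exact (M _ _ _ Sq (Il x I))].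
    + split; [|split].
      * exact (forced_sub _ _ _ _ _ S3 (proj1 (K q3 b H1))).
      * exact (forced_sub _ _ _ _ _ S3 H2).
      * exact (cpath_sub e q q5 _ Sq Cl).
    + destruct Sq; lia.
    + rewrite (ext_lab _ _ X5) by (simpl; lia). unfold q4.
      rewrite relabel2_lab1; auto.
    + rewrite <- app_assoc. apply accepts_app.
      * intros x [<-|[]]; auto.
      * eapply accepts_sub; eauto.
  - assert (S3 : sub q3 q5) by apply X5.
    apply (Good1 q5 Z3 u3 y3); eauto using ext_trans.
    + intros x I. eapply M; eauto. apply HZ3; auto.
    + eapply apath_sub; eauto.
    + destruct S3; lia.
    + rewrite (ext_lab _ _ X5) by (simpl; lia). unfold q4.
      rewrite relabel2_lab2; auto; lia.
    + eapply accepts_sub; eauto.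
Qed.

(** * The generic order *)

Fixpoint encode (c : code) : nat :=
  match c with
  | Zero => <| 0, 0 |>
  | Succ => <| 1, 0 |>
  | Fst => <| 2, 0 |>
  | Snd => <| 3, 0 |>
  | Query => <| 4, 0 |>
  | Pair f g => <| 5, <| encode f, encode g |> |>
  | Comp f g => <| 6, <| encode f, encode g |> |>
  | Prec f g => <| 7, <| encode f, encode g |> |>
  | Mu f => <| 8, encode f |>
  end.

Lemma pair_inj a b c d : <| a, b |> = <| c, d |> -> a = c /\ b = d.
Proof. intros H. apply to_nat_inj in H. inversion H. auto. Qed.

Lemma encode_inj c d : encode c = encode d -> c = d.
Proof.
  revert d. induction c; destruct d; cbn [encode]; intros H;
    apply pair_inj in H as [H H']; try discriminate; auto;
    try (apply pair_inj in H' as [H' H'']); f_equal; auto.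
Qed.

Record task := Task { index : code; creq : req; areq : req }.

Definition encode_req (rho : req) : nat :=
  <| encode (prog rho), <| if iso rho then 1 else 0, low rho |> |>.

Lemma encode_req_inj r r' : encode_req r = encode_req r' -> r = r'.
Proof.
  destruct r as [f k n], r' as [f' k' n']. unfold encode_req; cbn [prog iso low].
  intros H. apply pair_inj in H as [H H']. apply pair_inj in H' as [H' H''].
  apply encode_inj in H. destruct k, k'; try discriminate; subst; auto.
Qed.

Definition encode_task (t : task) : nat :=
  <| encode (index t), <| encode_req (creq t), encode_req (areq t) |> |>.

Lemma encode_task_inj t t' : encode_task t = encode_task t' -> t = t'.
Proof.
  destruct t, t'. unfold encode_task; cbn [index creq areq].
  intros H. apply pair_inj in H as [H H']. apply pair_inj in H' as [H' H''].
  apply encode_inj in H. apply encode_req_inj in H', H''. subst; auto.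
Qed.

(** Dependent choice, in the form that meets countably many dense sets. *)
Lemma generic_sequence {T} (ok : T -> Prop) (le : T -> T -> Prop)
    (D : nat -> T -> Prop) (t0 : T) :
  ok t0 ->
  (forall n t, ok t -> exists t', ok t' /\ le t' t /\ D n t') ->
  exists f : nat -> T, forall n, ok (f n) /\ le (f (S n)) (f n) /\ D n (f (S n)).
Proof.
  intros H0 H.
  assert (step : forall n (t : {t | ok t}),
            {t' : {t' | ok t'} | le (proj1_sig t') (proj1_sig t) /\ D n (proj1_sig t')}).
  { intros n [t Ht]. apply constructive_indefinite_description.
    destruct (H n t Ht) as (t' & H1 & H2). exists (exist _ t' H1). auto. }
  set (f := nat_rect (fun _ => {t | ok t}) (exist _ t0 H0)
              (fun n t => proj1_sig (step n t))).
  exists (fun n => proj1_sig (f n)). intros n. split.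
  - apply proj2_sig.
  - exact (proj2_sig (step n (f n))).
Qed.

Definition fails (e : code) (p : cond) : Prop :=
  (exists N, forall q b, ext q p -> N <= b -> ~ elt e q b) \/
  (exists z, forall q, ext q p -> ~ forced e q z 1 /\ ~ forced e q z 0).

(** If no extension bounds [elt e] or blocks the answers 0 and 1 somewhere, then [elt e] is dense
    and [e] is decided, so it can serve as the first reservoir. *)
Lemma initial_state e p :
  (forall q, ext q p -> ~ fails e q) -> vstate e p (State [] [] (elt e)).
Proof.
  intros H. split; simpl; auto.
  - intros q z X. apply NNPP. intros F. apply (H q X). right. exists z.
    intros q' X'. split; intros G; apply F; eauto.
  - intros q q' b S. apply forced_sub. auto.
  - intros q X N. apply NNPP. intros F. apply (H q X). left. exists N.
    intros q' b X' Hb G. apply F. eauto.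
  - intros q b G. split; auto. split; auto. intros a [].
Qed.

Record gcond := GCond { base : cond; states : code -> option state }.

Definition gvalid (g : gcond) : Prop :=
  valid (base g) /\
  forall e s, states g e = Some s -> vstate e (base g) s.

Definition gext (g' g : gcond) : Prop :=
  ext (base g') (base g) /\
  forall e s, states g e = Some s ->
    exists s', states g' e = Some s' /\ xstate (base g') s' s.

Definition handled (t : task) (g : gcond) : Prop :=
  fails (index t) (base g) \/
  exists s, states g (index t) = Some s /\
    (met (cpath (index t)) (base g) (res s) (chn s) (creq t) \/
     met (apath (index t)) (base g) (res s) (ant s) (areq t)).

Definition goal (n : nat) (g : gcond) : Prop :=
  n <= sz (base g) /\ forall t, encode_task t = n -> handled t g.

Lemma code_eq_dec (c d : code) : {c = d} + {c <> d}.
Proof. decide equality. Defined.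

Lemma gvalid_ext q g :
  gvalid g -> ext q (base g) ->
  gvalid (GCond q (states g)) /\ gext (GCond q (states g)) g.
Proof.
  intros [V W] X. split; split; simpl; auto.
  - apply X.
  - intros e s H. eapply vstate_ext; eauto.
  - intros e s H. exists s. split; auto using xstate_refl.
Qed.

Lemma goal_dense n g : gvalid g -> exists g', gvalid g' /\ gext g' g /\ goal n g'.
Proof.
  intros V. destruct (ext_large (base g) n (proj1 V)) as (q1 & X1 & Hn).
  destruct (classic (exists t, encode_task t = n)) as [[t Ht]|F].
  2:{ exists (GCond q1 (states g)). destruct (gvalid_ext q1 g V X1).
      repeat (split; auto). intros t Ht. exfalso. eauto. }
  assert (U : forall t', encode_task t' = n -> t' = t)
    by (intros t' E; apply encode_task_inj; congruence).
  set (e := index t).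
  destruct (classic (exists q, ext q q1 /\ fails e q)) as [(q & X & F)|F].
  { assert (X0 : ext q (base g)) by eauto using ext_trans.
    exists (GCond q (states g)). destruct (gvalid_ext q g V X0).
    split; auto. split; auto. split.
    - assert (sz q1 <= sz q) by apply X. simpl. lia.
    - intros t' E. rewrite (U t' E). left. auto. }
  assert (S : exists s, vstate e q1 s /\
            (forall s0, states g e = Some s0 -> s0 = s)).
  { destruct (states g e) as [s|] eqn:E.
    - exists s. split; [|congruence]. eapply vstate_ext; eauto. apply V; auto.
    - exists (State [] [] (elt e)). split; [|congruence]. apply initial_state.
      intros q X G. apply F. eauto. }
  destruct S as (s & Vs & Es).
  destruct (progress e q1 s (creq t) (areq t) (ext_valid _ _ X1) Vs)
    as (q & s' & X & Vs' & Xs & M).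
  assert (X0 : ext q (base g)) by eauto using ext_trans.
  exists (GCond q (fun d => if code_eq_dec d e then Some s' else states g d)).
  split; [|split]; split; simpl.
  - apply X.
  - intros d s0. destruct (code_eq_dec d e) as [->|Hd].
    + intros H. inversion H. subst. auto.
    + intros H. eapply vstate_ext; eauto. apply V; auto.
  - auto.
  - intros d s0 H. destruct (code_eq_dec d e) as [->|Hd].
    + exists s'. rewrite (Es s0 H). auto.
    + exists s0. split; auto using xstate_refl.
  - assert (sz q1 <= sz q) by apply X. lia.
  - intros t' E. rewrite (U t' E). right. exists s'. simpl. fold e.
    destruct (code_eq_dec e e); tauto.
Qed.

(** * The limit of the generic sequence *)

Record limit (p : nat -> cond) (r : nat -> nat -> Prop) : Prop := {
  lim_ext : forall n m, n <= m -> ext (p m) (p n);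
  lim_size : forall n, n <= sz (p (S n));
  lim_matches : forall n, matches (p n) r;
  lim_stable : forall n x y, x < sz (p n) -> sz (p n) <= y ->
    stable (lab (p n) x) r x y
}.

Lemma limit_exists p :
  (forall n m, n <= m -> ext (p m) (p n)) -> (forall n, n <= sz (p (S n))) ->
  exists r, limit p r.
Proof.
  intros X Z.
  set (r := fun x y => exists n, x < sz (p n) /\ y < sz (p n) /\ rel (p n) x y).
  assert (M : forall n, matches (p n) r).
  { intros n x y Hx Hy. split; [|unfold r; eauto].
    intros (m & Hx' & Hy' & H). destruct (le_ge_dec n m) as [L|L].
    - apply (proj2 (ext_sub _ _ (X n m L))); auto.
    - apply (proj2 (ext_sub _ _ (X m n L))); auto. }
  exists r. split; auto. intros n x y Hx Hy.
  set (m := max n (S (S y))).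
  assert (Xm : ext (p m) (p n)) by (apply X; lia).
  assert (Hm : S y <= sz (p m)).
  { assert (Xy : ext (p m) (p (S (S y)))) by (apply X; lia).
    specialize (Z (S y)). assert (sz (p (S (S y))) <= sz (p m)) by apply Xy. lia. }
  assert (sz (p n) <= sz (p m)) by apply Xm.
  apply (stable_iff _ (rel (p m))).
  - symmetry. apply M; lia.
  - symmetry. apply M; lia.
  - apply Xm; lia.
Qed.

Lemma lim_le_size p r k n : limit p r -> k < n -> k <= sz (p n).
Proof.
  intros L H. pose proof (lim_size _ _ L k).
  assert (sz (p (S k)) <= sz (p n)) by (apply (lim_ext _ _ L); lia). lia.
Qed.

Lemma limit_instance p r : limit p r -> instance CAC (oracle r).
Proof.
  intros L.
  assert (B : forall x y z, exists n, valid (p n) /\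
            x < sz (p n) /\ y < sz (p n) /\ z < sz (p n)).
  { intros x y z. exists (S (S (max x (max y z)))). split.
    - apply (ext_valid _ (p 0)). apply (lim_ext _ _ L). lia.
    - pose proof (lim_le_size p r (S (max x (max y z))) _ L (le_n _)). lia. }
  split.
  - split; [|split; [|split]].
    + intros. split; apply carrier_oracle.
    + intros x _. rewrite order_oracle. destruct (B x x x) as (n & V & ?).
      apply (lim_matches _ _ L n); try apply V; tauto.
    + intros x y. rewrite !order_oracle. destruct (B x y x) as (n & V & ? & ? & _).
      pose proof (lim_matches _ _ L n) as M. unfold matches in M.
      rewrite !M by auto. apply V; auto.
    + intros x y z. rewrite !order_oracle.
      destruct (B x y z) as (n & V & ? & ? & ?).
      pose proof (lim_matches _ _ L n) as M. unfold matches in M.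
      rewrite !M by auto. apply V; auto.
  - intros [l Hl].
    assert (H : forall x, In x l -> x <= list_max l).
    { apply Forall_forall, list_max_le. auto. }
    specialize (H (S (list_max l)) (Hl _ (carrier_oracle r _))). lia.
Qed.

(** A halting computation uses finitely much of [r], and late conditions fix that part. *)
Lemma limit_forced p r e z v :
  limit p r -> eval (oracle r) e z v ->
  exists n, forall m, n <= m -> forced e (p m) z v.
Proof.
  intros L H. destruct (eval_continuous e z v _ H) as [k Hk].
  exists (S k). intros m Hm r' Hr'. apply Hk. apply oracle_agree.
  pose proof (lim_le_size p r k m L Hm).
  intros x y Hx Hy. rewrite (lim_matches _ _ L m x y), (Hr' x y) by lia. tauto.
Qed.

(** * Infinite sets, and one side of the construction *)

Lemma infinite_ge A N : infinite A -> exists x, N <= x /\ A x.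
Proof.
  intros H. apply NNPP. intros F. apply H. exists (seq 0 N).
  intros x Hx. apply in_seq. destruct (le_lt_dec N x); [exfalso; eauto|lia].
Qed.

Lemma ge_infinite (A : set) : (forall N, exists x, N <= x /\ A x) -> infinite A.
Proof.
  intros H [l Hl]. destruct (H (S (list_max l))) as (x & Hx & Ax).
  assert (K : forall x, In x l -> x <= list_max l).
  { apply Forall_forall, list_max_le. auto. }
  specialize (K x (Hl x Ax)). lia.
Qed.

(** Common to the two sides: [prj] is [chn] or [ant], and [st n s] says that the
    construction for a fixed index is in state [s] at stage [n]. *)
Record run (p : nat -> cond) (st : nat -> state -> Prop)
    (prj : state -> list nat) (ok : cond -> list nat -> Prop) : Prop := {
  run_next : forall n m s, n <= m -> st n s -> exists s', st m s' /\
    exists l, prj s' = l ++ prj s /\ forall x, In x l -> res s (p m) x;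
  run_fun : forall n s s', st n s -> st n s' -> s = s';
  run_ok : forall n s, st n s -> ok (p n) (prj s);
  run_mono : forall n s, st n s -> monotone (res s);
  run_dense : forall n s, st n s -> dense (p n) (res s);
  run_cons : forall n s q b, st n s -> ext q (p n) -> res s q b ->
    ok q ([b] ++ prj s);
  run_met : forall rho, exists n s, st n s /\
    met ok (p n) (res s) (prj s) rho
}.

Definition collect (st : nat -> state -> Prop) (prj : state -> list nat) : set :=
  fun x => exists n s, st n s /\ In x (prj s).

Lemma run_join p st prj ok n m s t :
  run p st prj ok -> st n s -> st m t ->
  exists w, st (max n m) w /\
    (exists l, prj w = l ++ prj s /\ forall x, In x l -> res s (p (max n m)) x) /\
    forall x, In x (prj t) -> In x (prj w).
Proof.
  intros H Hs Ht.
  destruct (run_next _ _ _ _ H n (max n m) s (Nat.le_max_l _ _) Hs) as (w & Hw & K).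
  destruct (run_next _ _ _ _ H m (max n m) t (Nat.le_max_r _ _) Ht)
    as (w' & Hw' & l' & El' & _).
  rewrite (run_fun _ _ _ _ H _ _ _ Hw' Hw) in El'.
  exists w. split; auto. split; auto.
  intros x I. rewrite El'. apply in_or_app; auto.
Qed.

Lemma run_infinite p r st prj ok :
  limit p r -> run p st prj ok -> infinite (collect st prj).
Proof.
  intros L H. apply ge_infinite. intros N.
  (* [Comp Succ Zero] always outputs 1, so accepting only asks for an element at least [N]. *)
  destruct (run_met _ _ _ _ H (Req (Comp Succ Zero) true N)) as (n & s & Hs & [M|M]).
  - destruct M as (y & u & _ & _ & [(x & Ix & Hx) _] & _).
    exists x. split; auto. exists n, s. auto.
  - exfalso.
    destruct (run_dense _ _ _ _ H n s Hs (p n)) with (N := N) as (q & b & X & Hb & Rb).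
    { apply (lim_ext _ _ L); auto. }
    destruct (ext_large q (S (sz (p n))) (ext_valid _ _ X)) as (q' & X' & Hq).
    assert (Rb' : res s q' b).
    { apply (run_mono _ _ _ _ H n s Hs q q'); auto. apply X'. }
    assert (X0 : ext q' (p n)) by eauto using ext_trans.
    apply (M q' [b] 0 (sz (p n)) X0).
    + intros x [<-|[]]. auto.
    + eapply run_cons; eauto.
    + lia.
    + split.
      * exists b. simpl. auto.
      * intros. simpl. eauto.
Qed.

(** Applying [run_met] to the program computing [S], with both kinds, puts into [S] an [Inc] point
    and a point that is [Up] or [Down]. The former rules out an infinite chain, the latter an
    infinite antichain. *)
Lemma run_defeats p r st prj ok S :
  limit p r -> run p st prj ok ->
  turing_reducible S (join (oracle r) (collect st prj)) ->
  ~ solution CAC (oracle r) S.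
Proof.
  intros L H [f Hf] [IS Sol].
  set (Y := collect st prj) in *.
  assert (K : forall k, exists n y, y < sz (p n) /\ kind k (lab (p n) y) /\ S y).
  { intros k. destruct (run_met _ _ _ _ H (Req f k 0)) as (n & s & Hs & M).
    destruct M as [(y & u & Hy & Hk & [_ A] & Hu)|M].
    - exists n, y. split; auto. split; auto.
      assert (E : eval (join (oracle r) Y) f y 1).
      { apply A; [apply (lim_matches _ _ L)|]. intros z Hz. split; [|exists n, s; auto].
        intros (m & s' & Hs' & Iz).
        destruct (run_join _ _ _ _ n m s s' H Hs Hs') as (t & _ & (l & El & Hl) & Hl').
        assert (J : In z (prj t)) by auto.
        rewrite El in J. apply in_app_or in J as [J|J]; auto.
        specialize (Hu _ _ (Hl z J)). lia. }
      apply Hf in E. destruct E as [[? _]|[_ E]]; [auto|discriminate].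
    (* An infinite [S] has an element [y] beyond [p n], and a long enough finite part of [Y] accepts
       it, against the second alternative of [met]. *)
    - exfalso. destruct (infinite_ge S (sz (p n)) IS) as (y & Hy & Sy).
      assert (E : eval (join (oracle r) Y) f y 1) by (apply Hf; left; auto).
      destruct (eval_continuous f y 1 _ E) as [u Hu].
      assert (U : forall v : nat, exists m t, n <= m /\ st m t /\
                (forall z, z < v -> (Y z <-> In z (prj t)))).
      { induction v as [|v (m & t & Hm & Ht & IH)].
        - exists n, s. split; auto. split; auto. intros; lia.
        - destruct (classic (Y v)) as [(m' & t' & Ht' & Iv)|F].
          + destruct (run_join _ _ _ _ m m' t t' H Ht Ht') as (w & Hw & (l & El & _) & Hl').
            exists (max m m'), w. split; [lia|]. split; auto.
            intros z Hz. split; [|exists (max m m'), w; auto]. intros Yz.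
            destruct (Nat.eq_dec z v) as [->|Hzv].
            * auto.
            * rewrite El. apply in_or_app. right. apply IH; auto; lia.
          + exists m, t. split; auto. split; auto.
            intros z Hz. split; [|exists m, t; auto]. intros Yz.
            apply IH; auto. assert (z <> v) by congruence. lia. }
      destruct (infinite_ge Y 0 (run_infinite p r st prj ok L H)) as (x & _ & Yx).
      destruct (U (max u (x + 1))) as (m & t & Hm & Ht & Ag).
      set (m' := max m (max (y + 2) (u + 1))).
      destruct (run_next _ _ _ _ H m m' t ltac:(lia) Ht) as (t1 & Ht1 & l1 & El1 & _).
      destruct (run_next _ _ _ _ H n m' s ltac:(lia) Hs) as (t2 & Ht2 & l & El & Hl).
      rewrite (run_fun _ _ _ _ H _ _ _ Ht2 Ht1) in El.
      assert (Ag' : forall z, z < u -> (Y z <-> In z (prj t1))).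
      { intros z Hz. split; [|exists m', t1; auto]. intros Yz. rewrite El1.
        apply in_or_app. right. apply Ag; auto. lia. }
      apply (M (p m') l u y).
      + apply (lim_ext _ _ L). lia.
      + auto.
      + rewrite <- El. eapply run_ok; eauto.
      + pose proof (lim_le_size p r (y + 1) m' L ltac:(lia)). lia.
      + rewrite <- El. split.
        * exists x. split; [|simpl; lia]. rewrite El1. apply in_or_app. right.
          apply Ag; auto. lia.
        * simpl. intros r' Y' Hr' HY'. apply Hu. apply join_agree.
          -- apply oracle_agree. intros a b Ha Hb.
             pose proof (lim_le_size p r u m' L ltac:(lia)).
             rewrite (lim_matches _ _ L m' a b), (Hr' a b) by lia. tauto.
          -- intros z Hz. rewrite (Ag' z Hz), (HY' z Hz). tauto. }
  destruct Sol as [[_ C]|[_ C]].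
  - destruct (K true) as (n & y & Hy & Hk & Sy). simpl in Hk.
    destruct (infinite_ge S (sz (p n)) IS) as (y' & Hy' & Sy').
    pose proof (lim_stable _ _ L n y y' Hy Hy') as T. rewrite Hk in T. simpl in T.
    specialize (C y y' Sy Sy'). rewrite !order_oracle in C. tauto.
  - destruct (K false) as (n & y & Hy & Hk & Sy). simpl in Hk.
    destruct (infinite_ge S (sz (p n)) IS) as (y' & Hy' & Sy').
    pose proof (lim_stable _ _ L n y y' Hy Hy') as T.
    specialize (C y y' Sy Sy' ltac:(lia)). rewrite !order_oracle in C.
    destruct (lab (p n) y); simpl in T; tauto.
Qed.

(** * From forced facts to the coded poset, and the contradiction *)

Lemma cpath_chain e p X l :
  (forall x y, below e p x y -> order X x y) ->
  (forall x, elt e p x -> carrier X x) ->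
  is_poset (carrier X) (order X) -> cpath e p l ->
  forall x y, In x l -> In y l -> order X x y \/ order X y x.
Proof.
  intros B E (_ & Refl & _ & Trans) C.
  assert (H : forall b l, cpath e p (b :: l) -> forall x, In x (b :: l) -> order X x b).
  { clear l C. intros b l. revert b.
    induction l as [|a l IH]; intros b C x I; simpl in C, I.
    - destruct I as [<-|[]]. apply Refl, E, C.
    - destruct I as [<-|I]; [apply Refl, E, C|].
      apply (Trans x a b); [|apply B, C].
      apply IH; simpl; tauto. }
  induction l as [|b l IH]; intros x y Ix Iy; [destruct Ix|].
  destruct Ix as [<-|Ix].
  - right. eapply H; eauto.
  - destruct Iy as [<-|Iy].
    + left. eapply H; eauto. simpl; auto.
    + apply IH; auto. apply C.
Qed.

Lemma apath_antichain e p X l :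
  (forall x y, notbelow e p x y -> ~ order X x y) ->
  omega_ordered (order X) -> apath e p l ->
  forall x y, In x l -> In y l -> x <> y -> ~ order X x y /\ ~ order X y x.
Proof.
  intros B W. induction l as [|b l IH]; intros C x y Ix Iy N; [destruct Ix|].
  destruct C as (_ & F & C).
  assert (H : forall z, In z l -> ~ order X z b /\ ~ order X b z).
  { intros z I. destruct (F z I) as [L NB]. split; auto.
    intros O. apply W in O. lia. }
  destruct Ix as [<-|Ix], Iy as [<-|Iy].
  - congruence.
  - destruct (H y Iy). auto.
  - auto.
  - apply IH; auto.
Qed.

Theorem theorem5 : ~ computably_reducible CAC omega_CAC.
Proof.
  intros Red.
  destruct (generic_sequence gvalid gext goal
              (GCond (Cond 0 (fun _ _ => False) (fun _ => Up)) (fun _ => None)))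
    as (f & Hf).
  { split; simpl; [|discriminate]. split; simpl; intros; lia. }
  { apply goal_dense. }
  set (p := fun n => base (f n)).
  assert (V : forall n, gvalid (f n)) by apply Hf.
  assert (N : forall n m, n <= m -> gext (f m) (f n)).
  { intros n m Hm. induction Hm as [|m Hm IH].
    - split; [apply ext_refl, V|]. intros e s E. exists s. split; auto using xstate_refl.
    - destruct (Hf m) as (_ & [X S] & _). destruct IH as [X' S'].
      split; [eapply ext_trans; eauto|]. intros e s E.
      destruct (S' e s E) as (s1 & E1 & T1). destruct (S e s1 E1) as (s2 & E2 & T2).
      exists s2. split; auto. eapply xstate_trans; eauto; [|apply X].
      eapply v_mono. apply (V n). eauto. }
  assert (G : forall n, goal n (f (S n))) by apply Hf.
  destruct (limit_exists p) as [r L].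
  { intros n m Hm. apply (N n m Hm). }
  { intros n. apply (G n). }
  destruct (Red (oracle r) (limit_instance p r L)) as (X' & [[Po Inf] Om] & [e He] & Sol).
  (* Since [e] computes from [r] a poset with infinite carrier, no condition in the sequence can
     force it to fail. *)
  assert (NF : forall n, ~ fails e (p n)).
  { intros n [[k F]|[z F]].
    - destruct (infinite_ge _ k Inf) as (b & Hb & Cb).
      destruct (limit_forced p r e (2 * b) 1 L) as (m & Hm).
      { apply He. left. auto. }
      apply (F (p (max n m)) b); auto.
      + apply (lim_ext _ _ L). lia.
      + apply Hm. lia.
    - assert (E : exists v, (v = 1 \/ v = 0) /\ eval (oracle r) e z v).
      { destruct (classic (X' z)); [exists 1|exists 0]; split; auto;
          apply He; [left|right]; auto. }
      destruct E as (v & Hv & E). destruct (limit_forced p r e z v L E) as (m & Hm).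
      destruct (F (p (max n m))) as [F1 F0]; [apply (lim_ext _ _ L); lia|].
      specialize (Hm (max n m) ltac:(lia)). destruct Hv; subst; auto. }
  assert (T1 : forall n z, forced e (p n) z 1 -> X' z).
  { intros n z F. specialize (F r (lim_matches _ _ L n)). apply He in F.
    destruct F as [[? _]|[_ ?]]; [auto|discriminate]. }
  assert (T0 : forall n z, forced e (p n) z 0 -> ~ X' z).
  { intros n z F. specialize (F r (lim_matches _ _ L n)). apply He in F.
    destruct F as [[_ ?]|[? _]]; [discriminate|auto]. }
  set (st := fun n s => states (f n) e = Some s).
  assert (St : forall n s, st n s -> vstate e (p n) s) by (intros n s; apply V).
  assert (Sides : forall rho0 rho1, exists n s, st n s /\
    (met (cpath e) (p n) (res s) (chn s) rho0 \/
     met (apath e) (p n) (res s) (ant s) rho1)).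
  { intros rho0 rho1. set (t := Task e rho0 rho1).
    destruct (G (encode_task t)) as [_ H].
    destruct (H t eq_refl) as [F|(s & E & M)]; [destruct (NF _ F)|].
    exists (S (encode_task t)), s. auto. }
  (* If some [rho0] is never met on the chain side, pairing it with every [rho1] meets all
     requirements on the antichain side. *)
  destruct (classic (forall rho, exists n s, st n s /\
              met (cpath e) (p n) (res s) (chn s) rho)) as [C|C].
  - assert (R : run p st chn (cpath e)).
    { split; auto.
      - intros n m s Hm E. destruct (N n m Hm) as [_ K].
        destruct (K e s E) as (s' & E' & X). exists s'. split; auto. apply X.
      - unfold st. congruence.
      - intros n s E. apply (St n s E).
      - intros n s E. apply (St n s E).
      - intros n s E. apply (St n s E).
      - intros n s q b E X Rb. pose proof (St n s E) as W.
        destruct (v_res _ _ _ W q b Rb) as (A & B & _). split; auto. split; auto.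
        apply (cpath_sub e (p n)); [apply X|apply W]. }
    destruct (Sol (collect st chn)) as (Y & HY & TY).
    { split; [eapply run_infinite; eauto|]. left.
      split.
      { intros x (n & s & E & I). apply (T1 n).
        exact (cpath_elt _ _ _ x (v_chn _ _ _ (St n s E)) I). }
      intros x y (n & s & E & Ix) (m & t & E' & Iy).
      destruct (run_join _ _ _ _ n m s t R E E') as (w & Hw & (l & Hl & _) & Hl').
      apply (cpath_chain e (p (max n m)) X' (chn w)); auto.
      - intros a b. apply T1.
      - intros a. apply T1.
      - apply (St _ _ Hw).
      - rewrite Hl. apply in_or_app; auto. }
    exact (run_defeats p r st chn (cpath e) Y L R TY HY).
  - apply not_all_ex_not in C as [rho0 C].
    assert (R : run p st ant (apath e)).
    { split; auto.
      - intros n m s Hm E. destruct (N n m Hm) as [_ K].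
        destruct (K e s E) as (s' & E' & X). exists s'. split; auto. apply X.
      - unfold st. congruence.
      - intros n s E. apply (St n s E).
      - intros n s E. apply (St n s E).
      - intros n s E. apply (St n s E).
      - intros n s q b E X Rb. pose proof (St n s E) as W.
        destruct (v_res _ _ _ W q b Rb) as (A & _ & B). split; auto. split; auto.
        apply (apath_sub e (p n)); [apply X|apply W].
      - intros rho1. destruct (Sides rho0 rho1) as (n & s & E & [M|M]); eauto.
        exfalso. eauto. }
    destruct (Sol (collect st ant)) as (Y & HY & TY).
    { split; [eapply run_infinite; eauto|]. right.
      split.
      { intros x (n & s & E & I). apply (T1 n).
        exact (apath_elt _ _ _ x (v_ant _ _ _ (St n s E)) I). }
      intros x y (n & s & E & Ix) (m & t & E' & Iy).
      destruct (run_join _ _ _ _ n m s t R E E') as (w & Hw & (l & Hl & _) & Hl').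
      apply (apath_antichain e (p (max n m)) X' (ant w)); auto.
      - intros a b. apply T0.
      - apply (St _ _ Hw).
      - rewrite Hl. apply in_or_app; auto. }
    exact (run_defeats p r st ant (apath e) Y L R TY HY).
Qed.
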